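(* Let $n\in\mathbb{N}$, $d\ge0$ an integer, and $k\in[n+1]$. There is a bijection \[\rho:\{\mathbf{x}\in\mathrm{DPF}^\uparrow_{n,n,d}:x_n\le k\}\to\{\mathbf{y}\in\mathrm{PF}^\uparrow_{n+d,n+d}:y_{n+d}\le k-d\}\] such that $D(\mathbf{x})=F(\rho(\mathbf{x}))$ for every $\mathbf{x}$ in the domain.
   Context: For $\mathbf{x}\in[n+1]^n$: cars $1,\ldots,n$ arrive in order at an infinitely long street with spots $1,2,3,\ldots$, car $i$ parking in the first empty spot numbered $\ge x_i$; the defect is the number of cars parking in a spot numbered greater than $n$. $\mathrm{DPF}^\uparrow_{n,n,d}$ is the set of nondecreasing $\mathbf{x}\in[n+1]^n$ with defect $d$. $\mathrm{PF}^\uparrow_{N,N}$ is the set of nondecreasing $\mathbf{y}=(y_1,\ldots,y_N)$ of positive integers with $y_j\le j$ for all $j$ (nondecreasing parking functions). For $\mathbf{x}\in\mathrm{DPF}^\uparrow_{n,n,d}$ let $\delta(\mathbf{x})_i=x_i-i$; the decrement set $D(\mathbf{x})$ is the set of $i\in[n]$ with $\delta(\mathbf{x})_i\ge0$ such that no $j<i$ has $\delta(\mathbf{x})_j>0$. For $\mathbf{y}\in\mathrm{PF}^\uparrow_{N,N}$ the fixed set is $F(\mathbf{y})=\{j: y_j=j\}$. *)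

(* Defs.v *)
From mathcomp Require Import all_boot all_order all_algebra.

Set Implicit Arguments.
Unset Strict Implicit.
Unset Printing Implicit Defensive.

Import Order.TTheory GRing.Theory Num.Theory.

(* Entries, cars and spots are all numbered from 1: [entry x i] is x_i. It is
   only meaningful for 1 <= i <= size x. *)
Definition entry (x : seq nat) (i : nat) : nat := nth 0 x i.-1.

Lemma empty_spot_exists (occ : seq nat) (a : nat) :
  exists s, (a <= s) && (s \notin occ).
Proof.
exists (a + (sumn occ).+1); rewrite leq_addr /=; apply/negP => s_occ.
have: a + (sumn occ).+1 <= sumn occ.
  elim: occ (a + _) s_occ => [|b occ IH] s //=; rewrite inE.
  case/orP=> [/eqP-> | /IH le_s]; first exact: leq_addr.
  exact: leq_trans le_s (leq_addl _ _).
by rewrite addnS ltnNge leq_addl.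
Qed.

Definition first_empty (occ : seq nat) (a : nat) : nat :=
  ex_minn (empty_spot_exists occ a).

Definition occupied (x : seq nat) : seq nat :=
  foldl (fun occ a => first_empty occ a :: occ) [::] x.

Definition defect (n : nat) (x : n.-tuple nat) : nat :=
  count (fun s => n < s) (occupied x).

Definition DPFup (n d : nat) : pred (n.-tuple nat) :=
  fun x => [&& all (fun a => 1 <= a <= n.+1) x, sorted leq x & defect x == d].

Definition PFup (N : nat) : pred (N.-tuple nat) :=
  fun y => [&& all (fun a => 1 <= a) y, sorted leq y
             & all (fun j => entry y j <= j) (iota 1 N)].

Definition delta (x : seq nat) (i : nat) : int :=
  ((entry x i)%:Z - i%:Z)%R.

Definition decrement_set (n : nat) (x : n.-tuple nat) : pred nat :=
  fun i => [&& 1 <= i <= n, (0 <= delta x i)%R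
             & ~~ has (fun j => (0 < delta x j)%R) (iota 1 i.-1)].

Definition fixed_set (N : nat) (y : N.-tuple nat) : pred nat :=
  fun j => (1 <= j <= N) && (entry y j == j).

(* Main.v *)
Require Import Defs.
From mathcomp Require Import all_boot all_order all_algebra.
From mathcomp Require Import zify.

(** Read a nondecreasing [x] with entries at most [k] as a lattice path: the
    entries equal to [v] are [N] steps and there is an [E] step between the
    values [v] and [v + 1].  With height [#E - #N], the [i]-th [N] step starts at
    height [delta x i], and the defect is the maximal height [d] of the path.
    Turning into [N] the [d] steps [E] at which the path first reaches the heights
    [1, ..., d] produces a path that never rises above [0]; they are recovered as
    the last [N] steps leaving the heights [0, -1, ..., 1 - d], so the map is a
    bijection.  Up to the first turned step both paths agree, and that step is the
    last one of the new path to start at height [0]. *)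

Set Implicit Arguments.
Unset Strict Implicit.
Unset Printing Implicit Defensive.

(* [flipped d i M s y]: the entries [s] have indices [i, i + 1, ...], [M] steps
   have been turned before them, [d] have been turned at the end of [s], and
   [y] is the resulting list, whose entries have indices [i + M, i + M + 1, ...]. *)
Inductive flipped (d : nat) : nat -> nat -> seq nat -> seq nat -> Prop :=
| FlippedNil i : flipped d i d [::] [::]
| FlippedKeep i M x s y of M < x & x <= i + M & flipped d i.+1 M s y :
    flipped d i M (x :: s) (x - M :: y)
| FlippedTurn i M x s y of i + M < x & flipped d i M.+1 (x :: s) y :
    flipped d i M (x :: s) (i :: y).

Fixpoint max_excess (i M : nat) (s : seq nat) : nat :=
  if s is x :: s' then max_excess i.+1 (maxn M (x - i)) s' else M.

(** An [E] step leaving height [h] after [i - 1] steps [N] has [i - 1 + h] steps [E] before it. If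
    it sets a record, [h] of those are already turned, so it becomes an entry [i]. *)
Fixpoint flip (i M : nat) (s : seq nat) : seq nat :=
  if s is x :: s' then
    let M' := maxn M (x - i) in
    nseq (M' - M) i ++ (x - M') :: flip i.+1 M' s'
  else [::].

(* Scans [y] from the right; the first component counts the turned steps not yet
   undone. *)
Fixpoint unflip (d q : nat) (y : seq nat) : nat * seq nat :=
  if y is a :: y' then
    let: (M, s) := unflip d q.+1 y' in
    if q < a + M then (M.-1, s) else (M, a + M :: s)
  else (d, [::]).

(** * The turning map and its inverse *)

Lemma flip_flipped i M s c : 0 < i -> M < c -> path leq c s ->
  flipped (max_excess i M s) i M s (flip i M s).
Proof.
elim: s i M c => [|x s IH] i M c i_gt0 ltMc /=; first by move=> _; constructor.
case/andP=> le_cx s_path; set M' := maxn M (x - i).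
have {IH} := IH i.+1 M' x isT _ s_path.
have ltM'x : M' < x by rewrite /M'; lia.
move=> /(_ ltM'x); move: (max_excess _ _ _) (flip _ _ _) => d y Hy.
have : flipped d i M' (x :: s) (x - M' :: y).
  by apply: FlippedKeep => //; rewrite /M'; lia.
(* Either nothing is turned before [x], or every count from [M] up to [M' - 1] meets the guard of
   [FlippedTurn]; the turns are then added one by one. *)
have : M' = M \/ M' <= x - i by rewrite /M'; lia.
have : M <= M' by rewrite /M'; lia.
move: (x - M' :: y) => z {Hy ltM'x}.
move: M' => M'; move e: (M' - M) => m; elim: m M e {ltMc} => [|m IHm] M e leM H Hz.
  by have -> : M = M' by lia.
by apply: FlippedTurn; [lia | apply: IHm => //; lia].
Qed.

(** The guards of [FlippedKeep] and [FlippedTurn] exclude each other, so [i], [M] and [s] determine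
    the derivation. *)
Lemma flipped_fun d d' i M s y y' :
  flipped d i M s y -> flipped d' i M s y' -> d = d' /\ y = y'.
Proof.
move=> H; elim: H d' y' => {i M s y} [i|i M x s y ltM lex _ IH|i M x s y ltx _ IH] d' y' H'.
- by inversion H'.
- inversion H'; subst; last lia.
  by have [| -> ->] := IH d' y0.
- inversion H'; subst; first lia.
  by have [| -> ->] := IH d' y0.
Qed.

Lemma flipped_unflip d i M s y :
  flipped d i M s y -> unflip d (i + M) y = (M, s).
Proof.
elim=> {i M s y} [i|i M x s y ltM lex _ IH|i M x s y ltx _ IH] //=.
- by rewrite -addSn IH (subnK (ltnW ltM)) ltnNge lex.
- by rewrite -addnS IH addnS ltnSn.
Qed.

Lemma flipped_size d i M s y :
  flipped d i M s y -> size y + M = size s + d.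
Proof. by elim=> //= *; lia. Qed.

Lemma flipped_bound d i M s y :
  flipped d i M s y -> forall t, nth 0 y t <= i + t.
Proof.
elim=> {i M s y} [i|i M x s y ltM lex _ IH|i M x s y ltx _ IH] [|t] //=.
- by lia.
- by have := IH t; lia.
- by lia.
- by have := IH t; lia.
Qed.

Lemma flipped_path d i M s y c : flipped d i M s y ->
  0 < i -> M < c <= i + M -> path leq c s -> path leq (c - M) y.
Proof.
move=> H; elim: H c => {i M s y} [i|i M x s y ltM lex _ IH|i M x s y ltx _ IH] c //=.
- move=> i_gt0 c_bd /andP[lecx s_path].
  by rewrite leq_sub2r //=; apply: IH => //; lia.
(* The turned entry [i] is [c - M.+1] for [c = i + M.+1], which the guard bounds by [x]. *)
- move=> i_gt0 c_bd /andP[lecx s_path].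
  have := IH (i + M.+1) i_gt0; rewrite addnK /= s_path => ->; lia.
Qed.

(** A turn always precedes a kept entry, so the last kept entry is lowered by all [d] turns. *)
Lemma flipped_last d i M s y b :
  flipped d i M s y -> last b y + d = last (b + M) s.
Proof.
move=> H; elim: H b => {i M s y} [i|i M x s y ltM lex _ IH|i M x s y ltx _ IH] b //=.
by rewrite IH (subnK (ltnW ltM)).
Qed.

Lemma flipped_fixed d i s y t : flipped d i 0 s y ->
  (t < size y /\ nth 0 y t = i + t) <->
  [/\ t < size s, i + t <= nth 0 s t & forall j, j < t -> nth 0 s j <= i + j].
Proof.
move e: 0 => M H; elim: H t e => {i M s y} [i|i M x s y ltM lex _ IH|i M x s y ltx H _] t e; subst.
- by split=> [[]|[]].
- rewrite subn0; case: t => [|t] /=.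
    split=> [[_ ->]|[_ le_x _]]; first by split.
    by split=> //; lia.
  have := IH t erefl; rewrite !addSnnS => {}IH; split.
    move=> [lt_t /(conj lt_t) /IH [ts le_s H]]; split=> // -[|j] lt_j /=; first lia.
    by have := H j lt_j; rewrite addSnnS.
  move=> [ts le_s H]; apply/IH; split=> // j lt_j.
  by have := H j.+1 lt_j; rewrite addSnnS.
- case: t => [|t] /=.
    by split=> _; split=> //; lia.
  split=> [[_ eq_t]|[_ _ /(_ 0 isT)] /=]; last lia.
  (* After the first turn, position [t] of the tail holds at most [i + t], one below its index. *)
  by have := flipped_bound H t; lia.
Qed.

(** The bound on the last entry puts its height at [- d] or lower, so the scan keeps it and starts
    with all [d] turns still to undo. *)
Lemma unflip_flipped d q a y :
    0 < a -> path leq a y -> last a y + d <= q + size y ->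
    (forall t, nth 0 (a :: y) t <= q + t) ->
  exists i M x s,
    [/\ unflip d q (a :: y) = (M, x :: s), flipped d i M (x :: s) (a :: y),
        q = i + M, a <= i & a + M <= x /\ path leq x s].
Proof.
elim: y q a => [|b y IH] q a a_gt0.
  rewrite /= addn0 => _ leq bd; exists (q - d), d, (a + d), [::].
  rewrite ltnNge leq /=; split=> //; try lia.
  have := @FlippedKeep d (q - d) d (a + d) [::] [::]; rewrite addnK.
  by apply; [lia | lia | apply: FlippedNil].
move=> /= /andP[leab b_path]; rewrite addnS -addSn => le_last bd.
have [||i [M [x [s [/= -> H eq_q le_bi [le_x s_path]]]]]] := IH q.+1 b _ b_path le_last.
- exact: leq_trans leab.
- by move=> t; have := bd t.+1; rewrite addSnnS.
have := bd 0; rewrite /= addn0 => le_aq.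
case: ltnP => [lt_q|ge_q].
  (* The test gives [i <= a], and the invariant gives [a <= b <= i]. *)
  have eq_ai : a = i by lia.
  case: M eq_q le_x lt_q H => [|M] eq_q le_x lt_q H; first lia.
  exists i, M, x, s; rewrite eq_ai; split=> //; try lia.
  by apply: (FlippedTurn _ H); lia.
case: i eq_q le_bi H => [|i] eq_q le_bi H; first lia.
exists i, M, (a + M), (x :: s); split=> //; try lia.
  have := @FlippedKeep d i M (a + M) (x :: s) (b :: y); rewrite addnK.
  by apply=> //; lia.
by split=> //=; rewrite s_path andbT; lia.
Qed.

Lemma unflip_parking d y :
    0 < size y -> path leq 1 y -> last 1 y + d <= size y ->
    (forall t, nth 0 y t <= t.+1) ->
  let s := (unflip d 1 y).2 in path leq 1 s /\ flipped d 1 0 s y.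
Proof.
case: y => //= a y _ /andP[a_gt0 y_path] le_last bd.
have [i [M [x [s [/= -> H eq_q le_ai [le_x s_path]]]]]] :=
  unflip_flipped (q := 1) a_gt0 y_path le_last bd.
(* From [1 = i + M] and [0 < a <= i]: at index 1 every turn has been undone. *)
have [eq_i eq_M] : i = 1 /\ M = 0 by lia.
by rewrite eq_i eq_M in H *; rewrite /= s_path andbT; split=> //; lia.
Qed.

(** * The defect as a maximal height *)

Lemma first_empty_max occ c t a :
    {in occ, forall s, s <= t} -> (forall s, c <= s <= t -> s \in occ) ->
  c <= a -> first_empty occ a = maxn a t.+1.
Proof.
move=> occ_le occ_ge le_ca; rewrite /first_empty; case: ex_minnP => s /andP[le_as s_free] s_min.
have lt_ts : t < s by rewrite ltnNge; apply: contra s_free => le_st; apply: occ_ge; lia.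
have : s <= maxn a t.+1; last by lia.
apply: s_min; rewrite leq_maxl /=; apply/negP => /occ_le; lia.
Qed.

(* After [i - 1] cars the last occupied spot is [i - 1 + M]; since no preference
   exceeds [n + 1], every spot between [n] and the last occupied one is taken. *)
Lemma count_parked n i M c occ s :
    0 < i ->
    {in occ, forall u, u < i + M} -> (forall u, c <= u < i + M -> u \in occ) ->
    path leq c s -> all (fun a => a <= n.+1) s ->
    count (fun u => n < u) occ = (i + M).-1 - n ->
  count (fun u => n < u) (foldl (fun occ a => first_empty occ a :: occ) occ s)
    = (i + size s + max_excess i M s).-1 - n.
Proof.
elim: s i M c occ => [|a s IH] i M c occ i_gt0 occ_lt occ_ge /=; first by rewrite addn0.
move=> /andP[le_ca s_path] /andP[le_an s_le] eq_count.
have -> : first_empty occ a = i + maxn M (a - i).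
  rewrite (@first_empty_max _ c (i + M).-1) //; first lia.
    by move=> u /occ_lt; lia.
  by move=> u u_bd; apply: occ_ge; lia.
rewrite -addSnnS; apply: (IH _ _ a) => //.
- by move=> u; rewrite inE => /orP[/eqP->|/occ_lt]; lia.
(* A car that skips spots parks at [a] itself; otherwise the range from [a] up to its spot lies in
   the old full block. *)
- move=> u u_bd; rewrite inE; case: eqP => //= ne_u; apply: occ_ge; lia.
- by rewrite /= eq_count; case: ltnP; lia.
Qed.

Lemma defect_max_excess n (x : n.-tuple nat) :
  path leq 1 x -> all (fun a => a <= n.+1) x -> defect x = max_excess 1 0 x.
Proof.
move=> x_path x_le; rewrite /defect /occupied (@count_parked n 1 0 1) //; last by move=> u; lia.
by rewrite size_tuple; lia.
Qed.

(** * The two sets and the decrement set in list form *)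

Lemma path_leq_last c s : path leq c s -> all (fun a => a <= last c s) (c :: s).
Proof.
elim: s c => [|a s IH] c /=; first by rewrite leqnn.
by case/andP=> le_ca /IH /= /andP[le_a ->]; rewrite le_a (leq_trans le_ca).
Qed.

Lemma entry_last N (y : N.-tuple nat) c : 0 < N -> entry y N = last c y.
Proof.
move=> N_gt0; rewrite /entry -{2}(size_tuple y) nth_last.
by case: (tval y) (size_tuple y) => //= eq_N; rewrite -eq_N in N_gt0.
Qed.

Lemma DPFup_lastE n d k (x : n.-tuple nat) : 0 < n -> k <= n.+1 ->
  DPFup d x && (entry x n <= k) =
  [&& path leq 1 x, last 1 x <= k & max_excess 1 0 x == d].
Proof.
move=> n_gt0 le_kn; rewrite (entry_last _ 1) // /DPFup.
have -> : all (fun a => 1 <= a <= n.+1) x =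
    all (leq 1) x && all (fun a => a <= n.+1) x.
  by rewrite -all_predI.
have := path_sortedE leq_trans 1 x; have [x_path|_] := boolP (path leq 1 x); last first.
  by case: (all (leq 1) x) => //= <-; rewrite andbF.
move=> /esym/andP[-> ->] /=.
have [le_xk|] := leqP (last 1 x) k; last by rewrite !andbF.
have x_le : all (fun a => a <= n.+1) x.
  by case/andP: (path_leq_last x_path) => _; apply: sub_all => a /=; lia.
by rewrite x_le defect_max_excess // andbT.
Qed.

Lemma PFup_lastP N d k (y : N.-tuple nat) : 0 < N ->
  reflect [/\ path leq 1 y, last 1 y + d <= k & forall t, nth 0 y t <= t.+1]
    (PFup y && ((entry y N)%:Z <= k%:Z - d%:Z)%R).
Proof.
move=> N_gt0; rewrite (entry_last _ 1) // /PFup andbA -(path_sortedE leq_trans).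
have -> : ((last 1%N y)%:Z <= k%:Z - d%:Z)%R = (last 1 y + d <= k) by lia.
apply: (iffP andP) => [[/andP[y_path /allP bd] le_k]|[y_path le_k bd]]; split=> //.
(* Past the end, the default 0 meets the bound. *)
- move=> t; case: (ltnP t N) => lt_t; last by rewrite nth_default ?size_tuple.
  by apply: (bd t.+1); rewrite mem_iota; lia.
- by rewrite y_path; apply/allP => -[|j]; rewrite mem_iota // => _; apply: bd.
Qed.

Lemma decrement_setP n (x : n.-tuple nat) t :
  reflect [/\ t < n, t < nth 0 x t & forall j, j < t -> nth 0 x j <= j.+1]
    (decrement_set x t.+1).
Proof.
rewrite /decrement_set /delta /entry /=.
have -> : (0 <= (nth 0%N x t)%:Z - t.+1%:Z)%R = (t < nth 0 x t) by lia.
apply: (iffP and3P) => [[lt_t le_x no_j]|[lt_t le_x no_j]]; split=> //.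
- move=> j lt_j; rewrite leqNgt; apply: contra no_j => lt_x.
  by apply/hasP; exists j.+1; rewrite ?mem_iota /=; lia.
- apply/hasPn => -[|j]; rewrite mem_iota //= => lt_j.
  by have := no_j j; lia.
Qed.

Theorem theorem4p13 (n d k : nat) (hn : 1 <= n) (hk : 1 <= k <= n.+1) :
  exists rho :
      {x : n.-tuple nat | DPFup d x && (entry x n <= k)} ->
      {y : (n + d).-tuple nat |
         PFup y && ((entry y (n + d))%:Z <= k%:Z - d%:Z)%R},
    bijective rho /\
    forall x, decrement_set (sval x) =i fixed_set (sval (rho x)).
Proof.
have [_ le_kn] := andP hk.
have N_gt0 : 0 < n + d by rewrite addn_gt0 hn.
pose X := {x : n.-tuple nat | DPFup d x && (entry x n <= k)}.
pose Y := {y : (n + d).-tuple nat |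
  PFup y && ((entry y (n + d))%:Z <= k%:Z - d%:Z)%R}.
have flipX (x : X) : flipped d 1 0 (tval (sval x)) (flip 1 0 (tval (sval x))).
  have := svalP x; rewrite DPFup_lastE // => /and3P[x_path _ /eqP eq_d].
  by have := flip_flipped (i := 1) (M := 0) (c := 1) isT isT x_path; rewrite eq_d.
have unflipY (y : Y) : let s := (unflip d 1 (tval (sval y))).2 in
    path leq 1 s /\ flipped d 1 0 s (tval (sval y)).
  have /PFup_lastP := svalP y => /(_ N_gt0) [y_path le_k bd].
  apply: unflip_parking => //; rewrite size_tuple //.
  (* For [d = 0] the parking condition bounds the last entry by [n]; for [d > 0],
     [k <= n + 1 <= n + d]. *)
  have := bd (n + d).-1; rewrite -/(entry _ (n + d)) (entry_last _ 1) // prednK //.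
  by case: (posnP d); lia.
have rhoP (x : X) : {y : Y | tval (sval y) = flip 1 0 (tval (sval x))}.
  have sz : size (flip 1 0 (tval (sval x))) == n + d.
    by have := flipped_size (flipX x); rewrite addn0 size_tuple => ->.
  suff yP : PFup (Tuple sz) && ((entry (Tuple sz) (n + d))%:Z <= k%:Z - d%:Z)%R.
    by exists (exist _ (Tuple sz) yP).
  have := svalP x; rewrite DPFup_lastE // => /and3P[x_path le_xk _].
  apply/PFup_lastP => //=; split.
  - exact: (flipped_path (c := 1) (flipX x)).
  - by rewrite (flipped_last 1 (flipX x)).
  - exact: flipped_bound (flipX x).
have sigP (y : Y) : {x : X | tval (sval x) = (unflip d 1 (tval (sval y))).2}.
  have [s_path H] := unflipY y; set s := _.2 in s_path H *.
  have sz : size s == n.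
    by have := flipped_size H; rewrite addn0 size_tuple => /addIn ->.
  suff xP : DPFup d (Tuple sz) && (entry (Tuple sz) n <= k).
    by exists (exist _ (Tuple sz) xP).
  have /PFup_lastP := svalP y => /(_ N_gt0) [_ le_last _].
  rewrite DPFup_lastE //= s_path -[last 1 s]/(last (1 + 0) s) -(flipped_last 1 H) le_last /=.
  (* Flipping [s] gives a second derivation, whose turn count is the maximal excess; uniqueness
     equates it with [d]. *)
  by have [eq_d _] := flipped_fun H (flip_flipped (i := 1) (M := 0) (c := 1) isT isT s_path); apply/eqP.
exists (fun x => sval (rhoP x)); split.
  exists (fun y => sval (sigP y)) => [x|y]; apply/val_inj/val_inj.
    by case: (sigP _) => x' /= ->; case: (rhoP x) => y /= ->; rewrite (flipped_unflip (flipX x)).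
  case: (rhoP _) => y' /= ->; case: (sigP y) => x /= ->.
  have [s_path H] := unflipY y.
  by have [_ <-] := flipped_fun H (flip_flipped (i := 1) (M := 0) (c := 1) isT isT s_path).
move=> x [|t] //; case: (rhoP x) => y /= eq_y.
have := flipped_fixed t (flipX x); rewrite -eq_y !size_tuple => fixP.
apply/decrement_setP/andP => [/fixP[lt_t eq_t]|[lt_t /eqP eq_t]].
  by split=> //; apply/eqP.
by apply/fixP.
Qed.
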